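(* Let $x(t)=(0,0,f(t))$, $y(t)=(y_1(t),y_2(t),y_3(t))$, $z(t)=(z_1(t),z_2(t),z_3(t))$ and $r(t)=\sqrt{y_1(t)^2+y_2(t)^2}$. Then $x,y,z$ describe a solution of the three-body problem with masses $m_1,m_2,m_2$ respectively that satisfies $r(0)\neq 0$ and $$m_1x(t)+m_2y(t)+m_2z(t)=(0,0,0)$$ if and only if $$y(t)=\Big(r(t)\cos\theta(t),\,r(t)\sin\theta(t),\,-\tfrac{m_1}{2m_2}f(t)\Big),\qquad z(t)=\Big(-r(t)\cos\theta(t),\,-r(t)\sin\theta(t),\,-\tfrac{m_1}{2m_2}f(t)\Big),$$ with $$\ddot f=\frac{-2m_2k f}{h^3},\qquad \ddot r=\frac{c_1^2}{r^3}-\frac{m_2}{4r^2}-2(k-1)m_2\frac{r}{h^3},\qquad r^2\dot\theta=c_1,$$ where $k=\frac{m_1+2m_2}{2m_2}$, $h=\sqrt{r^2+k^2f^2}$ and $c_1=y_1(0)\dot y_2(0)-y_2(0)\dot y_1(0)$.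
   Context: The gravitational constant is $1$ and the masses $m_1,m_2$ are positive. Three functions $x,y,z$ of time with values in $\mathbb{R}^3$ describe a solution of the three-body problem with masses $m_1,m_2,m_2$ if $$\ddot x=\frac{m_2(y-x)}{|y-x|^3}+\frac{m_2(z-x)}{|z-x|^3},\quad \ddot y=\frac{m_1(x-y)}{|x-y|^3}+\frac{m_2(z-y)}{|z-y|^3},\quad \ddot z=\frac{m_1(x-z)}{|x-z|^3}+\frac{m_2(y-z)}{|y-z|^3}.$$ Here $f$, $r$ and $\theta$ are real-valued functions of $t$.
   Formalization: Adds the hypothesis that if f vanishes identically then so does y_3; without it ''only if'' fails (f=0, z=-y, y a Kepler orbit about the origin in a tilted plane). On the right-hand side r(t)≠0 is made explicit. *)

(* Defs.v *)
From Stdlib Require Import Reals Lra.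
From Coquelicot Require Import Coquelicot.
Open Scope R_scope.

(* Coquelicot's norm on a product is the Euclidean combination of the norms of
   the factors, so [norm] on [R3] is the Euclidean norm: see [norm_R3]. *)
Notation R3 := (R * R * R)%type.

Lemma norm_R3 (a b c : R) :
  norm ((a, b, c) : R3) = sqrt (a ^ 2 + b ^ 2 + c ^ 2).
Proof.
change (sqrt (sqrt (Rabs a ^ 2 + Rabs b ^ 2) ^ 2 + Rabs c ^ 2)
        = sqrt (a ^ 2 + b ^ 2 + c ^ 2)).
rewrite pow2_sqrt; [now rewrite !pow2_abs|].
rewrite !pow2_abs; nra.
Qed.

(* [is_derive_n u 2 t a] is not used: it says nothing about the
   differentiability of [u], and exists only for real-valued [u]. *)
Definition is_second_derive {V : NormedModule R_AbsRing}
    (u : R -> V) (t : R) (a : V) : Prop :=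
  exists v : R -> V,
    locally t (fun s => is_derive u s (v s)) /\ is_derive v t a.

Definition attraction (m : R) (p q : R3) : R3 :=
  scal (m / norm (minus q p) ^ 3) (minus q p).

(* The inequalities make the quotients in the equations of motion meaningful:
   division by zero is total in Rocq. *)
Definition three_body_solution (I : R -> Prop) (m1 m2 m3 : R)
    (x y z : R -> R3) : Prop :=
  forall t, I t ->
    x t <> y t /\ x t <> z t /\ y t <> z t /\
    is_second_derive x t
      (plus (attraction m2 (x t) (y t)) (attraction m3 (x t) (z t))) /\
    is_second_derive y t
      (plus (attraction m1 (y t) (x t)) (attraction m3 (y t) (z t))) /\
    is_second_derive z t
      (plus (attraction m1 (z t) (x t)) (attraction m2 (z t) (y t))).

Definition time_interval (a b : Rbar) (t : R) : Prop :=
  Rbar_lt a t /\ Rbar_lt t b.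

(* Main.v *)
(* Since the centre of mass is at the origin, z = (-y1, -y2, -(m1/m2) f - y3), and
   the vanishing horizontal acceleration of x says that f (y3 - z3) y1 and
   f (y3 - z3) y2 vanish identically. The functions y1, y2 and y3 - z3 solve
   equations u'' = A u with continuous A, whose solutions vanish identically as
   soon as they vanish near one instant; as r(0) <> 0, either f or y3 - z3 is
   identically 0, and y3 = z3 (when f = 0, by [hf]). Absence of collisions then gives
   r <> 0 throughout, and (y1, y2) moves under a central force, with conserved
   angular momentum c1; the angle is an antiderivative of c1 / r^2. *)
Require Import Defs.
From Stdlib Require Import Reals Lra Classical.
From Coquelicot Require Import Coquelicot.
Open Scope R_scope.

(** * Open time intervals and functions with zero derivative *)

Lemma time_interval_locally (a b : Rbar) (t : R) :
  time_interval a b t -> locally t (time_interval a b).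
Proof.
intros Ht.
apply (open_and (fun s : R => Rbar_lt a s) (fun s : R => Rbar_lt s b));
  [apply open_Rbar_gt | apply open_Rbar_lt | exact Ht].
Qed.

Lemma time_interval_convex (a b : Rbar) (s t u : R) :
  time_interval a b s -> time_interval a b t ->
  Rmin s t <= u <= Rmax s t -> time_interval a b u.
Proof.
intros [Has Hsb] [Hat Htb] [Hu1 Hu2]; split.
- apply (Rbar_lt_le_trans _ (Rmin s t)); [|exact Hu1].
  unfold Rmin; destruct (Rle_dec s t); assumption.
- apply (Rbar_le_lt_trans _ (Rmax s t)); [exact Hu2|].
  unfold Rmax; destruct (Rle_dec s t); assumption.
Qed.

Lemma derive_zero_const (a b : Rbar) (g : R -> R) :
  (forall t, time_interval a b t -> is_derive g t 0) ->
  forall s t, time_interval a b s -> time_interval a b t -> g s = g t.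
Proof.
intros Hg s t Hs Ht.
destruct (MVT_gen g s t (fun _ => 0)) as [c [_ Hc]]; [| |lra].
- intros u Hu; apply Hg, (time_interval_convex a b s t); [assumption..|lra].
- intros u Hu; apply continuity_pt_filterlim.
  apply (ex_derive_continuous g); exists 0.
  apply Hg, (time_interval_convex a b s t); [assumption..|lra].
Qed.

(** * Second derivatives of scalar functions and of pairs *)

Lemma is_second_derive_ext_loc (V : NormedModule R_AbsRing) (u w : R -> V) t l :
  locally t (fun s => u s = w s) ->
  is_second_derive u t l -> is_second_derive w t l.
Proof.
intros Huw [v [Hv Hl]]; exists v; split; [|exact Hl].
apply locally_locally in Huw.
generalize (filter_and _ _ Huw Hv); apply filter_imp; intros s [Hs Hvs].
exact (is_derive_ext_loc u w s (v s) Hs Hvs).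
Qed.

(** Uniqueness of the derivative forces the witness [v] to coincide with [Derive u] near [t], so one
    velocity function serves at all instants. *)
Lemma is_second_deriveE (u : R -> R) (t l : R) :
  is_second_derive u t l <->
  locally t (fun s => ex_derive u s) /\ is_derive (Derive u) t l.
Proof.
split.
- intros [v [Hv Hl]]; split.
  + revert Hv; apply filter_imp; intros s Hs; now exists (v s).
  + apply (is_derive_ext_loc v); [|exact Hl].
    revert Hv; apply filter_imp; intros s Hs.
    symmetry; now apply is_derive_unique.
- intros [Hu Hl]; exists (Derive u); split; [|exact Hl].
  revert Hu; apply filter_imp; intros s; apply Derive_correct.
Qed.

(** Projections and pairing are linear, so both directions are chain rules. This is what splits the
    equations of motion into coordinates. *)
Lemma is_derive_pair (V W : NormedModule R_AbsRing) (u : R -> V) (v : R -> W)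
    (t : R) (l : V) (m : W) :
  is_derive (fun s => (u s, v s)) t (l, m) <-> is_derive u t l /\ is_derive v t m.
Proof.
split.
- intros H; split.
  + refine (filterdiff_comp' (fun s => (u s, v s)) fst t _ fst H _).
    apply filterdiff_linear, is_linear_fst.
  + refine (filterdiff_comp' (fun s => (u s, v s)) snd t _ snd H _).
    apply filterdiff_linear, is_linear_snd.
- intros [Hu Hv].
  refine (filterdiff_comp'_2 u v (fun x y => (x, y)) t _ _ (fun x y => (x, y)) Hu Hv _).
  apply (filterdiff_ext_lin _ (fun p => p)); [|now intros []].
  apply (filterdiff_ext (fun p => p)); [now intros []|].
  apply filterdiff_id.
Qed.

Lemma is_second_derive_pair (V W : NormedModule R_AbsRing)
    (u : R -> V) (v : R -> W) (t : R) (l : V) (m : W) :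
  is_second_derive (fun s => (u s, v s)) t (l, m) <->
  is_second_derive u t l /\ is_second_derive v t m.
Proof.
split.
- intros [w [Hw Hl]].
  assert (Hw' : locally t (fun s => is_derive u s (fst (w s)) /\
                                    is_derive v s (snd (w s)))).
  { revert Hw; apply filter_imp; intros s Hs.
    apply is_derive_pair; now destruct (w s). }
  assert (Hl' : is_derive (fun s => fst (w s)) t l /\
                is_derive (fun s => snd (w s)) t m).
  { apply is_derive_pair; revert Hl; apply is_derive_ext.
    intros s; now destruct (w s). }
  split; [exists (fun s => fst (w s)) | exists (fun s => snd (w s))];
    (split; [|apply Hl']); revert Hw'; apply filter_imp; tauto.
- intros [[w1 [Hw1 Hl]] [w2 [Hw2 Hm]]]; exists (fun s => (w1 s, w2 s)); split.
  + generalize (filter_and _ _ Hw1 Hw2); apply filter_imp.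
    intros s; apply is_derive_pair.
  + now apply is_derive_pair.
Qed.

(** * Uniqueness for second-order linear equations *)

(* With [s = 1] or [s = -1] the sign of [t - t0], the energy [u^2 + v^2] damped
   by [exp (- s K t)] does not increase from [t0] to [t]. *)
Lemma linear_system_unique (u v A : R -> R) (t0 t : R) :
  (forall s, Rmin t0 t <= s <= Rmax t0 t ->
     continuous A s /\ is_derive u s (v s) /\ is_derive v s (A s * u s)) ->
  u t0 = 0 -> v t0 = 0 -> u t = 0.
Proof.
intros H Hu0 Hv0.
assert (Hle : Rmin t0 t <= Rmax t0 t).
{ apply Rle_trans with t0; [apply Rmin_l | apply Rmax_l]. }
destruct (continuity_ab_maj (fun s => Rabs (A s)) _ _ Hle) as [p [Hp _]].
{ intros s Hs; apply continuity_pt_filterlim.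
  apply (continuous_comp A Rabs); [now apply H | apply continuous_Rabs]. }
(* Since [p] maximises [Rabs (A q)] between [t0] and [t], [K] bounds [Rabs (1 + A q)] there. *)
set (K := 1 + Rabs (A p)).
assert (Hs : exists s, s * s = 1 /\ 0 <= s * (t - t0)).
{ destruct (Rle_dec t0 t); [exists 1 | exists (-1)]; lra. }
destruct Hs as [s [Hss Hst]].
set (g := fun q => (u q ^ 2 + v q ^ 2) * exp (- s * K * q)).
set (dg := fun q => (2 * u q * v q * (1 + A q) - s * K * (u q ^ 2 + v q ^ 2))
                    * exp (- s * K * q)).
assert (Hg : forall q, Rmin t0 t <= q <= Rmax t0 t -> is_derive g q (dg q)).
{ intros q Hq; destruct (H q Hq) as [_ [Hu Hv]].
  unfold g; auto_derive.
  - repeat split; eexists; eassumption.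
  - rewrite (is_derive_unique (fun x : R => u x) q _ Hu).
    rewrite (is_derive_unique (fun x : R => v x) q _ Hv).
    unfold dg; ring. }
destruct (MVT_gen g t0 t dg) as [c [Hc Heq]].
{ intros q Hq; apply Hg; lra. }
{ intros q Hq; apply continuity_pt_filterlim.
  apply (ex_derive_continuous g); exists (dg q); now apply Hg. }
assert (Hgt : g t <= 0).
{ assert (Hg0 : g t0 = 0) by (unfold g; rewrite Hu0, Hv0; ring).
  assert (HA : Rabs (s * (1 + A c)) <= K).
  { rewrite Rabs_mult.
    assert (Hs1 : Rabs s = 1).
    { rewrite <- sqrt_Rsqr_abs; unfold Rsqr; rewrite Hss; apply sqrt_1. }
    rewrite Hs1, Rmult_1_l; unfold K.
    pose proof (Rabs_triang 1 (A c)) as Htri; rewrite Rabs_R1 in Htri.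
    specialize (Hp c Hc); lra. }
  apply Rabs_le_between in HA.
  assert (Hdg : s * dg c <= 0).
  { unfold dg.
    replace (s * _) with
      (- ((K * (u c ^ 2 + v c ^ 2) - 2 * u c * v c * (s * (1 + A c)))
          * exp (- s * K * c))).
    - assert (0 <= K * (u c ^ 2 + v c ^ 2) - 2 * u c * v c * (s * (1 + A c))).
      (* Twice this form is [(K - w) * (u + v)^2 + (K + w) * (u - v)^2], with [w] between [- K] and
         [K]. *)
      { generalize dependent (s * (1 + A c)); intros w Hw.
        pose proof (pow2_ge_0 (u c + v c)); pose proof (pow2_ge_0 (u c - v c)).
        assert (0 <= (K - w) * (u c + v c) ^ 2) by (apply Rmult_le_pos; lra).
        assert (0 <= (K + w) * (u c - v c) ^ 2) by (apply Rmult_le_pos; lra).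
        lra. }
      pose proof (exp_pos (- s * K * c)); nra.
    - transitivity ((s * (2 * u c * v c * (1 + A c))
        - (s * s) * K * (u c ^ 2 + v c ^ 2)) * exp (- s * K * c)); [|ring].
      rewrite Hss; ring. }
  (* As [g t0 = 0], the mean value theorem gives [g t = dg c * (t - t0)]; inserting [s * s = 1]
     splits it into a nonpositive and a nonnegative factor. *)
  replace (g t) with ((s * dg c) * (s * (t - t0))); [nra|].
  transitivity ((s * s) * (dg c * (t - t0))); [ring|]; rewrite Hss; lra. }
unfold g in Hgt; pose proof (exp_pos (- s * K * t)).
assert (u t ^ 2 <= 0) by nra; nra.
Qed.

(** The coefficient [A] may be built from [u] itself: the equation is linear only along the given
    function, which lets nonlinear equations of motion qualify. *)
Definition linear_ode_solution (I : R -> Prop) (u : R -> R) : Prop :=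
  exists A : R -> R, forall t, I t ->
    continuous A t /\ is_second_derive u t (A t * u t).

Lemma linear_ode_zero (a b : Rbar) (u : R -> R) (t0 : R) :
  linear_ode_solution (time_interval a b) u -> time_interval a b t0 ->
  locally t0 (fun s => u s = 0) -> forall t, time_interval a b t -> u t = 0.
Proof.
intros [A HA] Ht0 Hloc t Ht.
apply (linear_system_unique u (Derive u) A t0 t).
- intros s Hs.
  destruct (HA s (time_interval_convex a b t0 t s Ht0 Ht Hs)) as [Hc Hd].
  apply is_second_deriveE in Hd; destruct Hd as [Hd Hdd].
  split; [exact Hc | split; [|exact Hdd]].
  apply Derive_correct; exact (locally_singleton _ _ Hd).
- exact (locally_singleton _ _ Hloc).
- rewrite (Derive_ext_loc u (fun _ => 0)); [apply Derive_const | exact Hloc].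
Qed.

(** If [g] is nonzero at one instant, it is nonzero nearby by continuity; there [u] vanishes, and
    [linear_ode_zero] spreads this over the whole interval. *)
Lemma linear_ode_mul_eq0 (a b : Rbar) (g u : R -> R) :
  (forall t, time_interval a b t -> continuous g t) ->
  linear_ode_solution (time_interval a b) u ->
  (forall t, time_interval a b t -> g t * u t = 0) ->
  (forall t, time_interval a b t -> g t = 0) \/
  (forall t, time_interval a b t -> u t = 0).
Proof.
intros Hg Hu H.
destruct (classic (forall t, time_interval a b t -> g t = 0)) as [|Hn]; [now left|].
right; apply not_all_ex_not in Hn; destruct Hn as [t0 Ht0].
apply imply_to_and in Ht0; destruct Ht0 as [It0 Hgt0].
apply (linear_ode_zero a b u t0 Hu It0).
assert (Hne : locally t0 (fun s => g s <> 0)) by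
  exact (Hg t0 It0 _ (open_neq 0 _ Hgt0)).
generalize (filter_and _ _ Hne (time_interval_locally a b t0 It0)).
apply filter_imp; intros s [Hs Is].
destruct (Rmult_integral _ _ (H s Is)); [contradiction | assumption].
Qed.

(** * Polar coordinates along a planar curve *)

Lemma cos_sin_surj (p q : R) :
  p ^ 2 + q ^ 2 = 1 -> exists th, cos th = p /\ sin th = q.
Proof.
intros H.
assert (Hp : -1 <= p <= 1) by nra.
assert (Hq : sqrt (1 - p²) = Rabs q).
{ rewrite <- sqrt_Rsqr_abs; f_equal; unfold Rsqr; lra. }
destruct (Rle_dec 0 q) as [Hq0|Hq0].
(* The angle [acos p] has a nonnegative sine, so the sign of [q] decides between it and its
   opposite. *)
- exists (acos p); rewrite cos_acos, sin_acos, Hq by exact Hp.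
  split; [reflexivity | now apply Rabs_pos_eq].
- exists (- acos p); rewrite cos_neg, sin_neg, cos_acos, sin_acos, Hq by exact Hp.
  rewrite Rabs_left by lra; split; [reflexivity | ring].
Qed.

Lemma is_derive_hypot (u v : R -> R) (t du dv : R) :
  is_derive u t du -> is_derive v t dv -> u t ^ 2 + v t ^ 2 <> 0 ->
  is_derive (fun s => sqrt (u s ^ 2 + v s ^ 2)) t
    ((u t * du + v t * dv) / sqrt (u t ^ 2 + v t ^ 2)).
Proof.
intros Hu Hv Hne.
assert (Hpos : 0 < u t ^ 2 + v t ^ 2) by nra.
assert (Hs := sqrt_lt_R0 _ Hpos).
auto_derive.
- repeat split; [eexists; eassumption..|]; simpl in Hpos; lra.
- rewrite (is_derive_unique (fun x : R => u x) t _ Hu).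
  rewrite (is_derive_unique (fun x : R => v x) t _ Hv).
  replace (u t * (u t * 1) + v t * (v t * 1)) with (u t ^ 2 + v t ^ 2) by ring.
  field; lra.
Qed.

(** Both [(e, g)] and [(cos theta, sin theta)] turn at the rate [w], so their squared distance is
    constant, and it is [0] at time [0]. *)
Lemma rotating_unit_vector (a b : Rbar) (e g theta w : R -> R) :
  time_interval a b 0 ->
  (forall t, time_interval a b t ->
     is_derive e t (- w t * g t) /\ is_derive g t (w t * e t) /\
     is_derive theta t (w t)) ->
  e 0 = cos (theta 0) -> g 0 = sin (theta 0) ->
  forall t, time_interval a b t -> e t = cos (theta t) /\ g t = sin (theta t).
Proof.
intros I0 H He0 Hg0 t It.
assert (E : (e t - cos (theta t)) ^ 2 + (g t - sin (theta t)) ^ 2 = 0).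
{ transitivity ((e 0 - cos (theta 0)) ^ 2 + (g 0 - sin (theta 0)) ^ 2);
    [|rewrite He0, Hg0; ring].
  apply (derive_zero_const a b
    (fun s => (e s - cos (theta s)) ^ 2 + (g s - sin (theta s)) ^ 2));
    [|assumption..].
  clear t It; intros t It; destruct (H t It) as (He & Hg & Hth).
  auto_derive; [repeat split; eexists; eassumption|].
  rewrite (is_derive_unique (fun x : R => theta x) t _ Hth).
  rewrite (is_derive_unique (fun x : R => e x) t _ He).
  rewrite (is_derive_unique (fun x : R => g x) t _ Hg).
  ring. }
rewrite <- !Rsqr_pow2 in E; apply Rplus_sqr_eq_0 in E; lra.
Qed.

(** An angle chosen separately at each instant need not be continuous. It is chosen at time [0] only
    and continued as an antiderivative of [c / r^2]; the unit vector [(u / r, v / r)] turns at that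
    same rate. *)
Lemma polar_angle (a b : Rbar) (u v : R -> R) (c : R) :
  time_interval a b 0 ->
  (forall t, time_interval a b t ->
     ex_derive u t /\ ex_derive v t /\ u t * Derive v t - v t * Derive u t = c /\
     u t ^ 2 + v t ^ 2 <> 0) ->
  exists theta : R -> R, forall t, time_interval a b t ->
    u t = sqrt (u t ^ 2 + v t ^ 2) * cos (theta t) /\
    v t = sqrt (u t ^ 2 + v t ^ 2) * sin (theta t) /\
    is_derive theta t (c / (u t ^ 2 + v t ^ 2)).
Proof.
intros I0 H.
set (r := fun t => sqrt (u t ^ 2 + v t ^ 2)).
assert (Hr : forall t, time_interval a b t -> 0 < r t /\ r t ^ 2 = u t ^ 2 + v t ^ 2).
{ intros t It; destruct (H t It) as (_ & _ & _ & Hne).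
  split; [apply sqrt_lt_R0 | apply pow2_sqrt]; nra. }
set (w := fun t => c / (u t ^ 2 + v t ^ 2)).
assert (Hw : forall t, time_interval a b t -> continuous w t).
{ intros t It; destruct (H t It) as (Hu & Hv & _ & Hne).
  apply (ex_derive_continuous w); unfold w; auto_derive; repeat split; auto. }
destruct (cos_sin_surj (u 0 / r 0) (v 0 / r 0)) as [th0 [Hc0 Hs0]].
{ destruct (Hr 0 I0) as [Hr0 Hr2].
  transitivity ((u 0 ^ 2 + v 0 ^ 2) / r 0 ^ 2); [field; lra|].
  rewrite Hr2; field; rewrite <- Hr2; nra. }
set (theta := fun t => th0 + RInt w 0 t).
assert (Hth : forall t, time_interval a b t -> is_derive theta t (w t)).
{ intros t It; unfold theta.
  rewrite <- (Rplus_0_l (w t)).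
  apply (is_derive_plus (fun _ => th0) (fun s => RInt w 0 s));
    [apply (is_derive_const th0)|].
  apply (is_derive_RInt w _ 0); [|now apply Hw].
  generalize (time_interval_locally a b t It); apply filter_imp; intros s Is.
  apply (RInt_correct w), (ex_RInt_continuous w).
  intros p Hp; apply Hw, (time_interval_convex a b 0 s); assumption. }
assert (Hrd : forall t, time_interval a b t ->
          is_derive r t ((u t * Derive u t + v t * Derive v t) / r t)).
{ intros t It; destruct (H t It) as (Hu & Hv & _ & Hne).
  apply is_derive_hypot; [now apply Derive_correct..| exact Hne]. }
assert (HP : forall t, time_interval a b t ->
          u t / r t = cos (theta t) /\ v t / r t = sin (theta t)).
{ apply (rotating_unit_vector a b (fun t => u t / r t) (fun t => v t / r t) theta w).
  - exact I0.
  - intros t It; destruct (H t It) as (Hu & Hv & Hc & _).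
    destruct (Hr t It) as [Hr1 Hr2]; specialize (Hrd t It).
    split; [|split; [|now apply Hth]].
    + auto_derive; [repeat split; try assumption; try lra; eexists; eassumption|].
      rewrite (is_derive_unique (fun x : R => r x) t _ Hrd).
      change (Derive (fun x => u x) t) with (Derive u t).
      unfold w; rewrite <- Hr2, <- Hc.
      (* Expanding [r t ^ 2] turns the numerator into [- v t] times the angular momentum. *)
      transitivity ((Derive u t * r t ^ 2 -
        u t * (u t * Derive u t + v t * Derive v t)) / r t ^ 3); [field; lra|].
      rewrite Hr2 at 1; field; lra.
    + auto_derive; [repeat split; try assumption; try lra; eexists; eassumption|].
      rewrite (is_derive_unique (fun x : R => r x) t _ Hrd).
      change (Derive (fun x => v x) t) with (Derive v t).
      unfold w; rewrite <- Hr2, <- Hc.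
      transitivity ((Derive v t * r t ^ 2 -
        v t * (u t * Derive u t + v t * Derive v t)) / r t ^ 3); [field; lra|].
      rewrite Hr2 at 1; field; lra.
  - rewrite <- Hc0; unfold theta; rewrite RInt_point; f_equal; symmetry.
    apply Rplus_0_r.
  - rewrite <- Hs0; unfold theta; rewrite RInt_point; f_equal; symmetry.
    apply Rplus_0_r. }
exists theta; intros t It; destruct (HP t It) as [<- <-].
destruct (Hr t It) as [Hr1 _]; fold (r t).
split; [|split; [|exact (Hth t It)]]; field; lra.
Qed.

(** * Planar motion under a central force *)

Lemma second_derive_on (a b : Rbar) (u : R -> R) (l : R -> R) :
  (forall t, time_interval a b t -> is_second_derive u t (l t)) ->
  forall t, time_interval a b t ->
    is_derive u t (Derive u t) /\ is_derive (Derive u) t (l t).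
Proof.
intros H t It; destruct (proj1 (is_second_deriveE u t (l t)) (H t It)) as [Hu Hl].
split; [apply Derive_correct; exact (locally_singleton _ _ Hu) | exact Hl].
Qed.

Lemma is_second_derive_intro (a b : Rbar) (u v : R -> R) (t l : R) :
  time_interval a b t ->
  (forall s, time_interval a b s -> is_derive u s (v s)) -> is_derive v t l ->
  is_second_derive u t l.
Proof.
intros It Hu Hv; exists v; split; [|exact Hv].
generalize (time_interval_locally a b t It); apply filter_imp, Hu.
Qed.

(** In the derivative of the angular momentum the products of velocities cancel, and so do the force
    terms, because both accelerations carry the same factor [- K]. *)
Lemma central_force_angular_momentum (a b : Rbar) (u v K : R -> R) :
  (forall t, time_interval a b t -> is_second_derive u t (- K t * u t)) ->
  (forall t, time_interval a b t -> is_second_derive v t (- K t * v t)) ->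
  forall s t, time_interval a b s -> time_interval a b t ->
  u s * Derive v s - v s * Derive u s = u t * Derive v t - v t * Derive u t.
Proof.
intros Hu Hv s t Is It.
apply (derive_zero_const a b (fun p => u p * Derive v p - v p * Derive u p));
  [|assumption..].
clear s t Is It; intros t It.
destruct (second_derive_on _ _ _ _ Hu t It) as [Hu1 Hu2].
destruct (second_derive_on _ _ _ _ Hv t It) as [Hv1 Hv2].
replace 0 with ((Derive u t * Derive v t + u t * (- K t * v t))
                - (Derive v t * Derive u t + v t * (- K t * u t))) by ring.
apply (is_derive_minus (fun p => u p * Derive v p) (fun p => v p * Derive u p)).
- apply (is_derive_mult u (Derive v)); [assumption..|apply Rmult_comm].
- apply (is_derive_mult v (Derive u)); [assumption..|apply Rmult_comm].
Qed.

(** Differentiating [r' = (u u' + v v') / r] produces the centrifugal term through Lagrange's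
    identity [(u'^2 + v'^2) r^2 = (u u' + v v')^2 + c^2]. *)
Lemma central_force_radius (a b : Rbar) (u v K : R -> R) (c : R) :
  (forall t, time_interval a b t -> is_second_derive u t (- K t * u t)) ->
  (forall t, time_interval a b t -> is_second_derive v t (- K t * v t)) ->
  (forall t, time_interval a b t -> u t * Derive v t - v t * Derive u t = c) ->
  (forall t, time_interval a b t -> u t ^ 2 + v t ^ 2 <> 0) ->
  let r := fun t => sqrt (u t ^ 2 + v t ^ 2) in
  forall t, time_interval a b t ->
    is_second_derive r t (c ^ 2 / r t ^ 3 - K t * r t).
Proof.
intros Hu Hv Hc Hne r t It.
assert (Hr : 0 < r t /\ r t ^ 2 = u t ^ 2 + v t ^ 2).
{ specialize (Hne t It).
  split; [apply sqrt_lt_R0 | apply pow2_sqrt]; nra. }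
destruct Hr as [Hr1 Hr2].
assert (Hrd : forall s, time_interval a b s ->
          is_derive r s ((u s * Derive u s + v s * Derive v s) / r s)).
{ intros s Is; apply is_derive_hypot; [| |now apply Hne].
  - apply (second_derive_on _ _ _ _ Hu s Is).
  - apply (second_derive_on _ _ _ _ Hv s Is). }
apply (is_second_derive_intro a b r _ t _ It Hrd).
destruct (second_derive_on _ _ _ _ Hu t It) as [Hu1 Hu2].
destruct (second_derive_on _ _ _ _ Hv t It) as [Hv1 Hv2].
specialize (Hrd t It); rewrite <- (Hc t It).
set (du := Derive u) in *; set (dv := Derive v) in *.
auto_derive; [repeat split; try lra; eexists; eassumption|].
rewrite (is_derive_unique (fun x : R => r x) t _ Hrd).
rewrite (is_derive_unique (fun x : R => u x) t _ Hu1).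
rewrite (is_derive_unique (fun x : R => v x) t _ Hv1).
rewrite (is_derive_unique (fun x : R => du x) t _ Hu2).
rewrite (is_derive_unique (fun x : R => dv x) t _ Hv2).
transitivity (((du t ^ 2 + dv t ^ 2) * r t ^ 2 - (u t * du t + v t * dv t) ^ 2)
              / r t ^ 3 - K t * (u t ^ 2 + v t ^ 2) / r t); [field; lra|].
rewrite Hr2 at 1; rewrite <- Hr2 at 2; field; lra.
Qed.

(** The cosine coordinate suffices: the sine coordinate is the same statement for the angle shifted
    by [PI / 2]. *)
Lemma polar_central_force (a b : Rbar) (r theta K : R -> R) (c : R) :
  (forall t, time_interval a b t -> r t <> 0) ->
  (forall t, time_interval a b t ->
     is_second_derive r t (c ^ 2 / r t ^ 3 - K t * r t)) ->
  (forall t, time_interval a b t -> is_derive theta t (c / r t ^ 2)) ->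
  forall t, time_interval a b t ->
    is_second_derive (fun s => r s * cos (theta s)) t
      (- K t * (r t * cos (theta t))).
Proof.
intros Hne Hr Hth t It.
(* In the velocity, [r * theta'] is written as [c / r], so that differentiating again involves no
   second derivative of [theta]. *)
apply (is_second_derive_intro a b _
  (fun s => Derive r s * cos (theta s) - c / r s * sin (theta s)) t _ It).
- intros s Is; specialize (Hne s Is); specialize (Hth s Is).
  destruct (second_derive_on _ _ _ _ Hr s Is) as [Hr1 _].
  auto_derive; [repeat split; eexists; eassumption|].
  rewrite (is_derive_unique (fun x : R => theta x) s _ Hth).
  change (Derive (fun x => r x) s) with (Derive r s).
  field; exact Hne.
- specialize (Hne t It); specialize (Hth t It).
  destruct (second_derive_on _ _ _ _ Hr t It) as [Hr1 Hr2].
  set (dr := Derive r) in *.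
  auto_derive; [repeat split; try assumption; eexists; eassumption|].
  rewrite (is_derive_unique (fun x : R => theta x) t _ Hth).
  rewrite (is_derive_unique (fun x : R => r x) t _ Hr1).
  rewrite (is_derive_unique (fun x : R => dr x) t _ Hr2).
  field; exact Hne.
Qed.

(** * Inverse cubes of distances and the attraction in coordinates *)

(* The argument is a squared distance. *)
Definition icube (s : R) : R := / sqrt s ^ 3.

(* The difference quotient of [- icube], in a form continuous on the diagonal. *)
Definition icube_slope (s w : R) : R :=
  (s + sqrt s * sqrt w + w) / ((sqrt s + sqrt w) * sqrt s ^ 3 * sqrt w ^ 3).

Lemma icube_sub (s w : R) : 0 < s -> 0 < w ->
  icube s - icube w = icube_slope s w * (w - s).
Proof.
intros Hs Hw; unfold icube, icube_slope.
assert (Hs' := sqrt_lt_R0 _ Hs); assert (Hw' := sqrt_lt_R0 _ Hw).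
assert (Es := pow2_sqrt s (Rlt_le _ _ Hs)); assert (Ew := pow2_sqrt w (Rlt_le _ _ Hw)).
(* With the roots as variables, [s] and [w] become their squares and the claim is a rational
   identity. *)
generalize dependent (sqrt s); generalize dependent (sqrt w).
intros y Hy Ey x Hx Ex; subst s w; field; lra.
Qed.

Lemma icube_slope_pos (s w : R) : 0 < s -> 0 < w -> 0 < icube_slope s w.
Proof.
intros Hs Hw; unfold icube_slope.
assert (Hs' := sqrt_lt_R0 _ Hs); assert (Hw' := sqrt_lt_R0 _ Hw).
apply Rdiv_lt_0_compat.
- assert (0 < sqrt s * sqrt w) by now apply Rmult_lt_0_compat. lra.
- repeat apply Rmult_lt_0_compat; try apply pow_lt; lra.
Qed.

(** The squared distance is a free [s], so that one name can serve both directions of a pair, or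
    several pairs at equal distance. *)
Lemma attractionE (m p1 p2 p3 q1 q2 q3 s : R) :
  (q1 - p1) ^ 2 + (q2 - p2) ^ 2 + (q3 - p3) ^ 2 = s ->
  attraction m (p1, p2, p3) (q1, q2, q3) =
  (m * icube s * (q1 - p1), m * icube s * (q2 - p2), m * icube s * (q3 - p3)).
Proof.
intros <-; unfold attraction.
change (minus (q1, q2, q3) (p1, p2, p3)) with ((q1 - p1, q2 - p2, q3 - p3) : R3).
rewrite norm_R3; reflexivity.
Qed.

Lemma dist_sqr_pos (p1 p2 p3 q1 q2 q3 : R) :
  ((p1, p2, p3) : R3) <> (q1, q2, q3) ->
  0 < (q1 - p1) ^ 2 + (q2 - p2) ^ 2 + (q3 - p3) ^ 2.
Proof.
intros H.
pose proof (pow2_ge_0 (q1 - p1)); pose proof (pow2_ge_0 (q2 - p2)).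
pose proof (pow2_ge_0 (q3 - p3)).
destruct (Rle_lt_dec ((q1 - p1) ^ 2 + (q2 - p2) ^ 2 + (q3 - p3) ^ 2) 0) as [Hle|];
  [|assumption].
assert (Hz : forall w, w ^ 2 = 0 -> w = 0) by (intros w Hw; nra).
assert (q1 - p1 = 0) by (apply Hz; lra).
assert (q2 - p2 = 0) by (apply Hz; lra).
assert (q3 - p3 = 0) by (apply Hz; lra).
exfalso; apply H; repeat f_equal; lra.
Qed.

(** * Locality, algebra and coordinates of second derivatives *)

Lemma three_body_solution_ext (a b : Rbar) (m1 m2 m3 : R)
    (x y z x' y' z' : R -> R3) :
  (forall t, time_interval a b t -> x t = x' t /\ y t = y' t /\ z t = z' t) ->
  three_body_solution (time_interval a b) m1 m2 m3 x y z ->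
  three_body_solution (time_interval a b) m1 m2 m3 x' y' z'.
Proof.
intros E H t It; specialize (H t It).
destruct (E t It) as (<- & <- & <-).
destruct H as (Hxy & Hxz & Hyz & Hx & Hy & Hz).
assert (Hloc := time_interval_locally a b t It).
repeat (split; [assumption|]).
split; [|split]; (eapply is_second_derive_ext_loc; [|eassumption]);
  revert Hloc; apply filter_imp; intros s Is; apply (E s Is).
Qed.

Lemma is_second_derive_plus (V : NormedModule R_AbsRing) (u v : R -> V) t l m :
  is_second_derive u t l -> is_second_derive v t m ->
  is_second_derive (fun s => plus (u s) (v s)) t (plus l m).
Proof.
intros [u' [Hu Hl]] [v' [Hv Hm]]; exists (fun s => plus (u' s) (v' s)); split.
- generalize (filter_and _ _ Hu Hv); apply filter_imp; intros s [Hus Hvs].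
  now apply (is_derive_plus u v).
- now apply (is_derive_plus u' v').
Qed.

Lemma is_second_derive_scal (u : R -> R) (t k l : R) :
  is_second_derive u t l -> is_second_derive (fun s => k * u s) t (k * l).
Proof.
intros [u' [Hu Hl]]; exists (fun s => k * u' s); split.
- revert Hu; apply filter_imp; intros s; apply (is_derive_scal u).
- now apply (is_derive_scal u').
Qed.

Lemma is_second_derive_eq (u w : R -> R) (t l m : R) :
  is_second_derive u t l -> (forall s, u s = w s) -> l = m ->
  is_second_derive w t m.
Proof.
intros H Huw <-; revert H; apply is_second_derive_ext_loc, filter_forall, Huw.
Qed.

Lemma is_second_derive_opp (u : R -> R) (t l : R) :
  is_second_derive u t l -> is_second_derive (fun s => - u s) t (- l).
Proof.
intros H; apply (is_second_derive_eq _ _ _ _ _ (is_second_derive_scal u t (-1) l H));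
  intros; ring.
Qed.

Lemma is_second_derive_const (k t : R) : is_second_derive (fun _ => k) t 0.
Proof.
exists (fun _ => 0); split; [apply filter_forall; intros s|];
  apply @is_derive_const.
Qed.

Lemma is_second_derive_const_eq0 (k t l : R) :
  is_second_derive (fun _ => k) t l -> l = 0.
Proof.
intros H; apply is_second_deriveE in H; destruct H as [_ H].
rewrite <- (is_derive_unique _ _ _ H).
rewrite (Derive_ext _ (fun _ => 0)); [apply Derive_const|].
intros s; apply Derive_const.
Qed.

Lemma is_second_derive_R3 (u1 u2 u3 : R -> R) (t l1 l2 l3 : R) :
  is_second_derive (fun s => (u1 s, u2 s, u3 s) : R3) t ((l1, l2, l3) : R3) <->
  is_second_derive u1 t l1 /\ is_second_derive u2 t l2 /\ is_second_derive u3 t l3.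
Proof.
split.
- intros H; apply is_second_derive_pair in H; destruct H as [H H3].
  apply is_second_derive_pair in H; tauto.
- intros (H1 & H2 & H3); apply is_second_derive_pair; split; [|exact H3].
  now apply is_second_derive_pair.
Qed.

Lemma plus_R3 (p1 p2 p3 q1 q2 q3 : R) :
  plus ((p1, p2, p3) : R3) (q1, q2, q3) = (p1 + q1, p2 + q2, p3 + q3).
Proof. reflexivity. Qed.

(** * Equations of motion for horizontally opposite bodies *)

(** The first body stays on the axis, so the horizontal pulls of the other two on it must balance;
    this is the pair of equations in [icube s - icube w]. The heights [y3] and [z3] are still
    unrelated here. *)
Lemma antipodal_components (a b : Rbar) (m1 m2 : R) (f y1 y2 y3 z3 : R -> R) :
  m2 <> 0 ->
  three_body_solution (time_interval a b) m1 m2 m2 (fun t => (0, 0, f t))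
    (fun t => (y1 t, y2 t, y3 t)) (fun t => (- y1 t, - y2 t, z3 t)) ->
  forall t, time_interval a b t ->
  let s := y1 t ^ 2 + y2 t ^ 2 + (y3 t - f t) ^ 2 in
  let w := y1 t ^ 2 + y2 t ^ 2 + (z3 t - f t) ^ 2 in
  let e := 4 * (y1 t ^ 2 + y2 t ^ 2) + (z3 t - y3 t) ^ 2 in
  (0 < s /\ 0 < w /\ 0 < e) /\
  (icube s - icube w) * y1 t = 0 /\ (icube s - icube w) * y2 t = 0 /\
  is_second_derive f t (m2 * icube s * (y3 t - f t) + m2 * icube w * (z3 t - f t)) /\
  is_second_derive y1 t (- (m1 * icube s + 2 * m2 * icube e) * y1 t) /\
  is_second_derive y2 t (- (m1 * icube s + 2 * m2 * icube e) * y2 t) /\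
  is_second_derive y3 t
    (m1 * icube s * (f t - y3 t) + m2 * icube e * (z3 t - y3 t)).
Proof.
intros Hm2 H t It s w e; destruct (H t It) as (Hxy & Hxz & Hyz & Hx & Hy & _).
apply dist_sqr_pos in Hxy; apply dist_sqr_pos in Hxz; apply dist_sqr_pos in Hyz.
rewrite (attractionE m2 0 0 (f t) (y1 t) (y2 t) (y3 t) s) in Hx
  by (unfold s; ring).
rewrite (attractionE m2 0 0 (f t) (- y1 t) (- y2 t) (z3 t) w) in Hx
  by (unfold w; ring).
rewrite (attractionE m1 (y1 t) (y2 t) (y3 t) 0 0 (f t) s) in Hy
  by (unfold s; ring).
rewrite (attractionE m2 (y1 t) (y2 t) (y3 t) (- y1 t) (- y2 t) (z3 t) e) in Hy
  by (unfold e; ring).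
rewrite plus_R3 in Hx, Hy.
apply is_second_derive_R3 in Hx; destruct Hx as (Hx1 & Hx2 & Hx3).
apply is_second_derive_R3 in Hy; destruct Hy as (Hy1 & Hy2 & Hy3).
apply is_second_derive_const_eq0 in Hx1; apply is_second_derive_const_eq0 in Hx2.
split; [unfold s, w, e; repeat split; lra|].
split; [apply (Rmult_eq_reg_l m2); [lra|exact Hm2]|].
split; [apply (Rmult_eq_reg_l m2); [lra|exact Hm2]|].
split; [exact Hx3|].
split; [|split; [|exact Hy3]].
- replace (- _ * _) with (m1 * icube s * (0 - y1 t) + m2 * icube e * (- y1 t - y1 t))
    by ring.
  exact Hy1.
- replace (- _ * _) with (m1 * icube s * (0 - y2 t) + m2 * icube e * (- y2 t - y2 t))
    by ring.
  exact Hy2.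
Qed.

(** At equal heights the first body is equidistant from the other two, whose mutual distance is
    twice the horizontal radius; absence of collisions thus amounts to a nonzero radius. *)
Lemma isosceles_solution (a b : Rbar) (m1 m2 : R) (f y1 y2 y3 : R -> R) :
  m2 <> 0 ->
  three_body_solution (time_interval a b) m1 m2 m2 (fun t => (0, 0, f t))
    (fun t => (y1 t, y2 t, y3 t)) (fun t => (- y1 t, - y2 t, y3 t)) <->
  forall t, time_interval a b t ->
  let s := y1 t ^ 2 + y2 t ^ 2 + (y3 t - f t) ^ 2 in
  let K := m1 * icube s + 2 * m2 * icube (4 * (y1 t ^ 2 + y2 t ^ 2)) in
  y1 t ^ 2 + y2 t ^ 2 <> 0 /\
  is_second_derive f t (2 * m2 * icube s * (y3 t - f t)) /\
  is_second_derive y1 t (- K * y1 t) /\ is_second_derive y2 t (- K * y2 t) /\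
  is_second_derive y3 t (m1 * icube s * (f t - y3 t)).
Proof.
intros Hm2; split; intros H t It.
- destruct (antipodal_components _ _ _ _ _ _ _ _ _ Hm2 H t It)
    as (Hpos & _ & _ & Hf & H1 & H2 & H3).
  assert (Ee : 4 * (y1 t ^ 2 + y2 t ^ 2) + (y3 t - y3 t) ^ 2
               = 4 * (y1 t ^ 2 + y2 t ^ 2)) by ring.
  rewrite Ee in *; intros s K; repeat split; [lra| |exact H1|exact H2|].
  + replace (2 * m2 * icube s * (y3 t - f t)) with
      (m2 * icube s * (y3 t - f t) + m2 * icube s * (y3 t - f t)) by ring.
    exact Hf.
  + replace (m1 * icube s * (f t - y3 t)) with
      (m1 * icube s * (f t - y3 t) + m2 * icube (4 * (y1 t ^ 2 + y2 t ^ 2))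
         * (y3 t - y3 t)) by ring.
    exact H3.
- specialize (H t It).
  set (s := y1 t ^ 2 + y2 t ^ 2 + (y3 t - f t) ^ 2) in H.
  set (e := 4 * (y1 t ^ 2 + y2 t ^ 2)) in H.
  destruct H as (Hne & Hf & H1 & H2 & H3).
  rewrite (attractionE m2 0 0 (f t) (y1 t) (y2 t) (y3 t) s) by (unfold s; ring).
  rewrite (attractionE m2 0 0 (f t) (- y1 t) (- y2 t) (y3 t) s) by (unfold s; ring).
  rewrite (attractionE m1 (y1 t) (y2 t) (y3 t) 0 0 (f t) s) by (unfold s; ring).
  rewrite (attractionE m2 (y1 t) (y2 t) (y3 t) (- y1 t) (- y2 t) (y3 t) e)
    by (unfold e; ring).
  rewrite (attractionE m1 (- y1 t) (- y2 t) (y3 t) 0 0 (f t) s) by (unfold s; ring).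
  rewrite (attractionE m2 (- y1 t) (- y2 t) (y3 t) (y1 t) (y2 t) (y3 t) e)
    by (unfold e; ring).
  rewrite !plus_R3.
  (* Any coincidence of two bodies would force [y1 t = y2 t = 0]. *)
  split; [intros E; injection E as; apply Hne; nra|].
  split; [intros E; injection E as; apply Hne; nra|].
  split; [intros E; injection E as; apply Hne; nra|].
  split; [|split]; apply is_second_derive_R3; (split; [|split]).
  1, 2: apply (is_second_derive_eq _ _ _ _ _ (is_second_derive_const 0 t));
    intros; ring.
  (* Seven goals remain: [f]; [y1], [y2], [y3]; [- y1], [- y2], [y3]. The fifth and sixth are the
     negated ones. *)
  5: apply is_second_derive_opp in H1.
  6: apply is_second_derive_opp in H2.
  all: match goal with Hu : is_second_derive ?u ?t _ |- is_second_derive ?u ?t _ =>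
    apply (is_second_derive_eq _ _ _ _ _ Hu); [reflexivity | ring] end.
Qed.

(** * Equality of the heights of the two equal masses *)

Lemma equal_masses_level (a b : Rbar) (m1 m2 : R) (hm1 : 0 < m1) (hm2 : 0 < m2)
    (f y1 y2 y3 : R -> R) :
  let y t := (y1 t, y2 t, y3 t) : R3 in
  let z t := (- y1 t, - y2 t, - (m1 / m2) * f t - y3 t) : R3 in
  time_interval a b 0 ->
  ((forall t, time_interval a b t -> f t = 0) ->
   forall t, time_interval a b t -> y3 t = 0) ->
  three_body_solution (time_interval a b) m1 m2 m2 (fun t => (0, 0, f t)) y z ->
  y1 0 ^ 2 + y2 0 ^ 2 <> 0 ->
  forall t, time_interval a b t -> y3 t = - (m1 / (2 * m2)) * f t.
Proof.
intros y z I0 hf H Hr0.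
assert (Hq : 0 < m1 / m2) by now apply Rdiv_lt_0_compat.
set (q := m1 / m2) in *; set (z3 := fun t => - q * f t - y3 t).
set (D := fun t => y3 t - z3 t).
assert (Hc := antipodal_components a b m1 m2 f y1 y2 y3 z3 (Rgt_not_eq _ _ hm2) H).
set (s := fun t => y1 t ^ 2 + y2 t ^ 2 + (y3 t - f t) ^ 2).
set (w := fun t => y1 t ^ 2 + y2 t ^ 2 + (z3 t - f t) ^ 2).
set (e := fun t => 4 * (y1 t ^ 2 + y2 t ^ 2) + (z3 t - y3 t) ^ 2).
assert (Hex : forall t, time_interval a b t ->
  (ex_derive f t /\ ex_derive y1 t /\ ex_derive y2 t /\ ex_derive y3 t) /\
  0 < s t /\ 0 < w t /\ 0 < e t).
{ intros t It; destruct (Hc t It) as (Hpos & _ & _ & Hf & H1 & H2 & H3).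
  split; [|exact Hpos].
  apply is_second_deriveE in Hf, H1, H2, H3.
  repeat split; apply (locally_singleton _ (ex_derive _)); tauto. }
assert (Hsqrt : forall t, time_interval a b t ->
  (0 < sqrt (s t) /\ 0 < sqrt (w t) /\ 0 < sqrt (e t)) /\
  ex_derive (fun x => sqrt (s x)) t /\ ex_derive (fun x => sqrt (w x)) t /\
  ex_derive (fun x => sqrt (e x)) t).
{ intros t It; destruct (Hex t It) as ((Hf & H1 & H2 & H3) & Hs & Hw & He).
  split; [repeat split; now apply sqrt_lt_R0|].
  unfold s, w, e, z3 in *; repeat split; auto_derive; repeat split; trivial; lra. }
assert (Hcont : forall u : R -> R, (forall t, time_interval a b t -> ex_derive u t) ->
  forall t, time_interval a b t -> continuous u t).
{ intros u Hu t It; apply (ex_derive_continuous u); now apply Hu. }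
set (K := fun t => - (m1 * icube (s t) + 2 * m2 * icube (e t))).
assert (HK : forall t, time_interval a b t -> continuous K t).
{ apply Hcont; intros t It; destruct (Hsqrt t It) as ((P1 & P2 & P3) & Q1 & Q2 & Q3).
  (* Named, the square roots are plain functions to [auto_derive], with differentiability supplied
     by [Hsqrt]. *)
  set (rs := fun x => sqrt (s x)) in *; set (re := fun x => sqrt (e x)) in *.
  change (ex_derive (fun x => - (m1 * / rs x ^ 3 + 2 * m2 * / re x ^ 3)) t).
  auto_derive; repeat split; trivial;
    apply (pow_nonzero (_ t) 3), Rgt_not_eq; assumption. }
(* The inverse cubes of the distances from [x] to [y] and [z] differ by a multiple
   of [f * D], so the equation for [D] is linear homogeneous, even where [y] and
   [z] lie on the axis. *)
assert (HD : linear_ode_solution (time_interval a b) D).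
{ exists (fun t => - (m1 * icube (w t)) - 2 * m2 * icube (e t)
            + m1 * icube_slope (s t) (w t) * (q + 2) * f t * (f t - y3 t)).
  intros t It; split.
  - revert t It; apply Hcont; intros t It.
    destruct (Hex t It) as ((Hf & H1 & H2 & H3) & Hs & Hw & He).
    destruct (Hsqrt t It) as ((P1 & P2 & P3) & Q1 & Q2 & Q3).
    set (rs := fun x => sqrt (s x)) in *; set (re := fun x => sqrt (e x)) in *.
    set (rw := fun x => sqrt (w x)) in *.
    change (ex_derive (fun t => - (m1 * / rw t ^ 3) - 2 * m2 * / re t ^ 3
            + m1 * ((s t + rs t * rw t + w t) /
                ((rs t + rw t) * rs t ^ 3 * rw t ^ 3))
              * (q + 2) * f t * (f t - y3 t)) t).
    assert (Ds : ex_derive s t) by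
      (unfold s; auto_derive; repeat split; trivial).
    assert (Dw : ex_derive w t) by
      (unfold w, z3; auto_derive; repeat split; trivial).
    change (0 < rs t) in P1; change (0 < rw t) in P2; change (0 < re t) in P3.
    assert (rs t ^ 3 <> 0) by (apply pow_nonzero; lra).
    assert (rw t ^ 3 <> 0) by (apply pow_nonzero; lra).
    assert (re t ^ 3 <> 0) by (apply pow_nonzero; lra).
    assert ((rs t + rw t) * rs t ^ 3 * rw t ^ 3 <> 0).
    { repeat apply Rmult_integral_contrapositive_currified; trivial; lra. }
    auto_derive; repeat split; trivial.
  - destruct (Hex t It) as (_ & Hs & Hw & He).
    destruct (Hc t It) as (_ & _ & _ & Hf & _ & _ & H3).
    (* Since [D = 2 * y3 + q * f], its acceleration combines those of [y3] and [f]. *)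
    apply (is_second_derive_scal _ _ 2) in H3.
    apply (is_second_derive_scal _ _ q) in Hf.
    assert (HH := is_second_derive_plus _ _ _ _ _ _ H3 Hf).
    change (is_second_derive (fun x => 2 * y3 x + q * f x) t
      (2 * (m1 * icube (s t) * (f t - y3 t) + m2 * icube (e t) * (z3 t - y3 t)) +
       q * (m2 * icube (s t) * (y3 t - f t) + m2 * icube (w t) * (z3 t - f t)))) in HH.
    (* The difference [w - s] is that of the squares of [z3 - f] and [y3 - f], and it factors
       because [y3 + z3 = - q * f]. *)
    assert (Ha : icube (s t) = icube (w t) +
              icube_slope (s t) (w t) * ((q + 2) * (f t * D t))).
    { replace ((q + 2) * (f t * D t)) with (w t - s t)
        by (unfold w, s, D, z3; ring).
      rewrite <- icube_sub by assumption; ring. }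
    (* With [m1 = q * m2] the terms in [icube (w t)] combine into [- m1 * icube (w t) * D t], and
       every other term carries a factor [D t]. *)
    assert (Hm : m1 = q * m2) by (unfold q; field; lra).
    rewrite Ha, Hm in HH; rewrite Hm; clear Ha.
    generalize dependent (icube_slope (s t) (w t)); intros W HH; cbv beta.
    replace ((- _ - _ + _) * _) with
      (2 * (q * m2 * (icube (w t) + W * ((q + 2) * (f t * D t))) * (f t - y3 t)
            + m2 * icube (e t) * (z3 t - y3 t)) +
       q * (m2 * (icube (w t) + W * ((q + 2) * (f t * D t))) * (y3 t - f t)
            + m2 * icube (w t) * (z3 t - f t)))
      by (unfold D, z3; ring).
    revert HH; apply is_second_derive_ext_loc, filter_forall.
    intros x; change (2 * y3 x + q * f x = D x); unfold D, z3; ring. }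
assert (Hzero : forall t, time_interval a b t ->
  f t * D t * y1 t = 0 /\ f t * D t * y2 t = 0).
{ intros t It; destruct (Hex t It) as (_ & Hs & Hw & _).
  destruct (Hc t It) as (_ & E1 & E2 & _).
  change ((icube (s t) - icube (w t)) * y1 t = 0) in E1.
  change ((icube (s t) - icube (w t)) * y2 t = 0) in E2.
  rewrite icube_sub in E1, E2 by assumption.
  assert (HW := icube_slope_pos _ _ Hs Hw).
  assert (Hws : w t - s t = (q + 2) * (f t * D t))
    by (unfold w, s, D, z3; ring).
  rewrite Hws in E1, E2.
  assert (HWq : icube_slope (s t) (w t) * (q + 2) <> 0)
    by (apply Rmult_integral_contrapositive_currified; lra).
  split; apply (Rmult_eq_reg_l _ _ _) with (2 := HWq); lra. }
assert (HDf : forall t, time_interval a b t -> ex_derive f t /\ ex_derive D t).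
{ intros t It; destruct (Hex t It) as ((Hf & H1 & H2 & H3) & _).
  split; [exact Hf|].
  unfold D, z3; auto_derive; repeat split; trivial. }
assert (HfD : forall t, time_interval a b t -> f t * D t = 0).
{ assert (Hg : forall t, time_interval a b t -> continuous (fun x => f x * D x) t).
  { apply Hcont; intros t It; destruct (HDf t It).
    auto_derive; repeat split; trivial. }
  (* If [f * D] were not identically [0], both [y1] and [y2] would be, against [Hr0]. *)
  destruct (linear_ode_mul_eq0 a b (fun x => f x * D x) y1 Hg) as [|Z1];
    [|intros t It; now apply Hzero | assumption |].
  { exists K; intros t It; split; [now apply HK | apply (Hc t It)]. }
  destruct (linear_ode_mul_eq0 a b (fun x => f x * D x) y2 Hg) as [|Z2];
    [|intros t It; now apply Hzero | assumption |].
  { exists K; intros t It; split; [now apply HK | apply (Hc t It)]. }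
  exfalso; apply Hr0; rewrite (Z1 0 I0), (Z2 0 I0); ring. }
assert (Hy3 : (forall t, time_interval a b t -> f t = 0) \/
              (forall t, time_interval a b t -> D t = 0)).
{ apply linear_ode_mul_eq0; [apply Hcont; intros t It; now apply HDf|assumption..]. }
intros t It; replace (m1 / (2 * m2)) with (q / 2) by (unfold q; field; lra).
destruct Hy3 as [Z|Z].
- rewrite (Z t It), (hf Z t It); ring.
- specialize (Z t It); unfold D, z3 in Z; lra.
Qed.

(** * The equivalence with the reduced system for [f], [r] and [theta] *)

Theorem theorem2p1 (m1 m2 : R) (hm1 : 0 < m1) (hm2 : 0 < m2)
    (a b : Rbar) (ha : Rbar_lt a 0) (hb : Rbar_lt 0 b)
    (f y1 y2 y3 z1 z2 z3 : R -> R)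
    (* Vacuous unless f is identically 0, and implied by the right-hand side.
       "Only if" fails without it: f = 0, z = - y and y a Kepler orbit about
       the origin in a non-horizontal plane. *)
    (hf : (forall t, time_interval a b t -> f t = 0) ->
          forall t, time_interval a b t -> y3 t = 0) :
  let I := time_interval a b in
  let x := fun t => (0, 0, f t) : R3 in
  let y := fun t => (y1 t, y2 t, y3 t) : R3 in
  let z := fun t => (z1 t, z2 t, z3 t) : R3 in
  let r := fun t => sqrt (y1 t ^ 2 + y2 t ^ 2) in
  let k := (m1 + 2 * m2) / (2 * m2) in
  let h := fun t => sqrt (r t ^ 2 + k ^ 2 * f t ^ 2) in
  let c1 := y1 0 * Derive y2 0 - y2 0 * Derive y1 0 in
  (three_body_solution I m1 m2 m2 x y z /\
   r 0 <> 0 /\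
   (forall t, I t ->
      plus (plus (scal m1 (x t)) (scal m2 (y t))) (scal m2 (z t))
      = (0, 0, 0) :> R3))
  <->
  (exists theta : R -> R,
     forall t, I t ->
       y t = (r t * cos (theta t), r t * sin (theta t),
              - (m1 / (2 * m2)) * f t) /\
       z t = (- (r t * cos (theta t)), - (r t * sin (theta t)),
              - (m1 / (2 * m2)) * f t) /\
       (* the right-hand sides below are meaningful *)
       r t <> 0 /\
       is_second_derive f t (- 2 * m2 * k * f t / h t ^ 3) /\
       is_second_derive r t
         (c1 ^ 2 / r t ^ 3 - m2 / (4 * r t ^ 2)
          - 2 * (k - 1) * m2 * (r t / h t ^ 3)) /\
       ex_derive theta t /\
       r t ^ 2 * Derive theta t = c1).
Proof.

intros I x y z r k h c1.
assert (I0 : I 0) by (split; assumption).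
assert (Hm2 : m2 <> 0) by lra.
assert (Hkq : - (m1 / (2 * m2)) = 1 - k) by (unfold k; field; lra).
assert (Hm1 : m1 = 2 * (k - 1) * m2) by (unfold k; field; lra).
rewrite Hkq.
assert (Hr2 : forall t, r t ^ 2 = y1 t ^ 2 + y2 t ^ 2).
{ intros t; apply pow2_sqrt.
  apply Rplus_le_le_0_compat; apply pow2_ge_0. }
assert (Hrpos : forall t, r t <> 0 -> 0 < r t).
{ intros t Ht; pose proof (sqrt_pos (y1 t ^ 2 + y2 t ^ 2)); fold (r t) in *; lra. }
assert (Hrne : forall t, r t <> 0 <-> y1 t ^ 2 + y2 t ^ 2 <> 0).
{ intros t; rewrite <- Hr2; split; [apply pow_nonzero|].
  intros Hn E; apply Hn; rewrite E; ring. }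
assert (Hcom : forall t,
  plus (plus (scal m1 (x t)) (scal m2 (y t))) (scal m2 (z t)) =
  (m1 * 0 + m2 * y1 t + m2 * z1 t, m1 * 0 + m2 * y2 t + m2 * z2 t,
   m1 * f t + m2 * y3 t + m2 * z3 t)) by reflexivity.
set (s := fun t => y1 t ^ 2 + y2 t ^ 2 + (y3 t - f t) ^ 2).
set (K := fun t => m1 * icube (s t) + 2 * m2 * icube (4 * (y1 t ^ 2 + y2 t ^ 2))).
(* At this height [y3 - f = - k * f], so [s t] is the square of [h t]. *)
assert (Hs : forall t, y3 t = (1 - k) * f t -> icube (s t) = / h t ^ 3).
{ intros t E; unfold icube, s, h; rewrite Hr2, E; do 3 f_equal; ring. }
(* The equal masses attract each other over the distance [2 * r], and [2 * m2 / (2 * r)^3] times [r]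
   is the term [m2 / (4 * r^2)]. *)
assert (HK : forall t, r t <> 0 -> y3 t = (1 - k) * f t ->
  c1 ^ 2 / r t ^ 3 - m2 / (4 * r t ^ 2) - 2 * (k - 1) * m2 * (r t / h t ^ 3) =
  c1 ^ 2 / r t ^ 3 - K t * r t).
{ intros t Hn E; specialize (Hrpos t Hn); unfold K; rewrite (Hs t E).
  assert (Ei : icube (4 * (y1 t ^ 2 + y2 t ^ 2)) = / (2 * r t) ^ 3).
  { unfold icube; rewrite <- Hr2.
    replace (4 * r t ^ 2) with ((2 * r t) ^ 2) by ring.
    rewrite sqrt_pow2 by lra; reflexivity. }
  rewrite Ei, Hm1; unfold Rdiv; generalize (/ h t ^ 3); intros ih; field; lra. }
split.
- intros (H & Hr0 & Hc).
  assert (Hz : forall t, I t -> z1 t = - y1 t /\ z2 t = - y2 t /\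
                 z3 t = - (m1 / m2) * f t - y3 t).
  { intros t It; specialize (Hc t It); rewrite Hcom in Hc.
    injection Hc as E1 E2 E3; repeat split; apply (Rmult_eq_reg_l m2); trivial.
    - lra.
    - lra.
    - replace (m2 * (- (m1 / m2) * f t - y3 t)) with (- m1 * f t - m2 * y3 t)
        by (field; lra); lra. }
  assert (H' : three_body_solution I m1 m2 m2 x y
            (fun t => (- y1 t, - y2 t, - (m1 / m2) * f t - y3 t))).
  { revert H; apply three_body_solution_ext; intros t It.
    destruct (Hz t It) as (E1 & E2 & E3); unfold z; rewrite E1, E2, E3; auto. }
  assert (Hy3 := equal_masses_level a b m1 m2 hm1 hm2 f y1 y2 y3 I0 hf H'
            (proj1 (Hrne 0) Hr0)).
  rewrite Hkq in Hy3.
  (* Here [- (m1 / m2) = 2 * (1 - k)], so subtracting [y3 = (1 - k) * f] leaves the same height for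
     [z]. *)
  assert (Hz3 : forall t, I t -> z t = (- y1 t, - y2 t, y3 t)).
  { intros t It; destruct (Hz t It) as (E1 & E2 & E3); unfold z.
    rewrite E1, E2, E3, (Hy3 t It); f_equal; unfold k; field; lra. }
  assert (H'' := H); apply (three_body_solution_ext _ _ _ _ _ _ _ _ x y
    (fun t => (- y1 t, - y2 t, y3 t))) in H''; [|now auto].
  clear H H'; rename H'' into H.
  assert (HC := proj1 (isosceles_solution a b m1 m2 f y1 y2 y3 Hm2) H); cbv zeta in HC.
  assert (Hy1 : forall t, I t -> is_second_derive y1 t (- K t * y1 t))
    by (intros t It; apply (HC t It)).
  assert (Hy2 : forall t, I t -> is_second_derive y2 t (- K t * y2 t))
    by (intros t It; apply (HC t It)).
  assert (Hc1 : forall t, I t -> y1 t * Derive y2 t - y2 t * Derive y1 t = c1).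
  { intros t It; now apply (central_force_angular_momentum a b y1 y2 K). }
  assert (Hne : forall t, I t -> y1 t ^ 2 + y2 t ^ 2 <> 0)
    by (intros t It; apply (HC t It)).
  destruct (polar_angle a b y1 y2 c1 I0) as [theta Hth].
  { intros t It; repeat split; [| |now apply Hc1|now apply Hne].
    - exists (Derive y1 t); apply (second_derive_on _ _ _ _ Hy1 t It).
    - exists (Derive y2 t); apply (second_derive_on _ _ _ _ Hy2 t It). }
  exists theta; intros t It.
  destruct (Hth t It) as (E1 & E2 & Hd); fold (r t) in E1, E2.
  assert (Hrt : r t <> 0) by now apply Hrne, Hne.
  split; [|split; [|split; [exact Hrt|split; [|split; [|split]]]]].
  + unfold y; rewrite <- E1, <- E2, (Hy3 t It); reflexivity.
  + rewrite (Hz3 t It), <- E1, <- E2, (Hy3 t It); reflexivity.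
  + destruct (HC t It) as (_ & Hf & _); fold (s t) in Hf.
    apply (is_second_derive_eq _ _ _ _ _ Hf); [reflexivity|].
    rewrite (Hs t (Hy3 t It)), (Hy3 t It); unfold Rdiv; ring.
  + rewrite (HK t Hrt (Hy3 t It)).
    now apply (central_force_radius a b y1 y2 K c1).
  + eexists; exact Hd.
  + rewrite (is_derive_unique _ _ _ Hd), <- Hr2; field; exact Hrt.
- intros [theta H].
  assert (Hy : forall t, I t -> y1 t = r t * cos (theta t) /\
     y2 t = r t * sin (theta t) /\ y3 t = (1 - k) * f t).
  { intros t It; destruct (H t It) as (E & _); injection E; auto. }
  assert (Hz : forall t, I t -> z t = (- y1 t, - y2 t, y3 t)).
  { intros t It; destruct (Hy t It) as (-> & -> & ->); apply (H t It). }
  assert (Hrn : forall t, I t -> r t <> 0) by (intros t It; apply (H t It)).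
  assert (Hloc : forall t, I t -> locally t I) by apply time_interval_locally.
  split; [|split; [now apply Hrn|]].
  + apply (three_body_solution_ext _ _ _ _ _ x y (fun t => (- y1 t, - y2 t, y3 t)));
      [intros t It; rewrite (Hz t It); auto|].
    apply isosceles_solution; [exact Hm2|]; intros t It; cbv zeta.
    fold (s t); fold (K t).
    assert (Hrd : forall t, I t ->
              is_second_derive r t (c1 ^ 2 / r t ^ 3 - K t * r t)).
    { clear t It; intros t It; rewrite <- HK; [apply (H t It) | now apply Hrn|].
      apply (Hy t It). }
    assert (Hth : forall t, I t -> is_derive theta t (c1 / r t ^ 2)).
    { clear t It; intros t It; destruct (H t It) as (_ & _ & _ & _ & _ & Hex & Hd).
      rewrite <- Hd; replace (_ / _) with (Derive theta t) by (field; now apply Hrn).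
      now apply Derive_correct. }
    (* The shifted angle has the same rate, and its cosine is the sine of [theta]; this yields the
       equation for [y2]. *)
    assert (Hth' : forall t, I t ->
              is_derive (fun t => theta t - PI / 2) t (c1 / r t ^ 2)).
    { clear t It; intros t It; specialize (Hth t It).
      auto_derive; [now eexists; exact Hth|].
      rewrite (is_derive_unique (fun x : R => theta x) t _ Hth); ring. }
    assert (Hsin : forall p, cos (p - PI / 2) = sin p).
    { intros p; rewrite <- cos_neg, <- cos_shift; f_equal; ring. }
    destruct (Hy t It) as (E1 & E2 & E3).
    assert (Hf : is_second_derive f t (-2 * m2 * k * f t / h t ^ 3))
      by apply (H t It).
    split; [now apply Hrne, Hrn|].
    split; [|split; [|split]].
    * apply (is_second_derive_eq _ _ _ _ _ Hf); [reflexivity|].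
      rewrite (Hs t E3), E3; unfold Rdiv; ring.
    * rewrite E1; eapply is_second_derive_ext_loc;
        [|exact (polar_central_force a b r theta K c1 Hrn Hrd Hth t It)].
      generalize (Hloc t It); apply filter_imp; intros p Ip; symmetry; apply (Hy p Ip).
    * rewrite E2, <- Hsin; eapply is_second_derive_ext_loc;
        [|exact (polar_central_force a b r _ K c1 Hrn Hrd Hth' t It)].
      generalize (Hloc t It); apply filter_imp; intros p Ip; symmetry.
      rewrite Hsin; apply (Hy p Ip).
    (* The acceleration of [y3 = (1 - k) * f] matches the pull of the first body because
       [f - y3 = k * f] and [m1 = 2 * (k - 1) * m2]. *)
    * apply (is_second_derive_scal _ _ (1 - k)) in Hf.
      replace (m1 * icube (s t) * (f t - y3 t)) with
        ((1 - k) * (-2 * m2 * k * f t / h t ^ 3)).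
      2: { rewrite (Hs t E3), E3, Hm1; unfold Rdiv; ring. }
      revert Hf; apply is_second_derive_ext_loc.
      generalize (Hloc t It); apply filter_imp; intros p Ip; symmetry; apply (Hy p Ip).
  + intros t It; rewrite Hcom.
    assert (E := Hz t It); unfold z in E; injection E as -> -> ->.
    destruct (Hy t It) as (_ & _ & ->); repeat f_equal; rewrite ?Hm1; ring.
Qed.
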